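(* Fix $\mu\in\mathbb{R}^n$ (which determines the block structure). Let $U\in O^n$ be a block-diagonal orthogonal matrix. Let $M$ be an arbitrary real symmetric $n\times n$ matrix, and let $h\in\mathbb{R}^n$ be a vector such that $U^TM_{\mathrm{in}}U=\mathrm{Diag}\,h$. Let $H_1,\dots,H_k$ be arbitrary real $n\times n$ matrices, let $\sigma$ be a permutation on $\mathbb{N}_k$, and put $\tilde H_i=U^TH_iU$ for $i=1,\dots,k$. Then: 1. for any block-constant $(k+1)$-tensor $T$ on $\mathbb{R}^n$, $$\langle T[h],\tilde H_1\circ_\sigma\cdots\circ_\sigma\tilde H_k\rangle=\langle T,H_1\circ_{\sigma_{(k+1)}}\cdots\circ_{\sigma_{(k+1)}}H_k\circ_{\sigma_{(k+1)}}M_{\mathrm{in}}\rangle;$$ 2. for any block-constant $k$-tensor $T$ on $\mathbb{R}^n$, $$\langle T^{\tau_l}[h],\tilde H_1\circ_\sigma\cdots\circ_\sigma\tilde H_k\rangle=\langle T^{\tau_l}_{\mathrm{in}},H_1\circ_{\sigma_{(l)}}\cdots\circ_{\sigma_{(l)}}H_k\circ_{\sigma_{(l)}}M_{\mathrm{in}}\rangle\quad\text{for all } l=1,\dots,k.$$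
   Context: $\mathbb{N}_k=\{1,\dots,k\}$; $O^n$ is the set of real orthogonal $n\times n$ matrices; $\mathrm{Diag}\,x$ is the diagonal matrix with $x$ on the diagonal; matrix entries are written $H^{ij}$. A $k$-tensor on $\mathbb{R}^n$ is a $k$-linear map $(\mathbb{R}^n)^k\to\mathbb{R}$, identified with its array of components $T^{i_1\dots i_k}$, $i_s\in\mathbb{N}_n$. For a $(k+1)$-tensor $T$ and $h\in\mathbb{R}^n$, $T[h]$ is the $k$-tensor $(T[h])^{i_1\dots i_k}=\sum_{j=1}^nT^{i_1\dots i_kj}h^j$. $\langle T_1,T_2\rangle=\sum_{p_1,\dots,p_k}T_1^{p_1\dots p_k}T_2^{p_1\dots p_k}$. Equivalence: $i\sim j$ iff $\mu_i=\mu_j$. A tensor $T$ is block-constant if $T^{i_1\dots i_k}=T^{j_1\dots j_k}$ whenever $i_s\sim j_s$ for all $s$. A matrix $U$ is block-diagonal if $U^{ij}=0$ whenever $i\not\sim j$. For a square matrix $H$: $H_{\mathrm{in}}^{ij}=H^{ij}$ if $i\sim j$ and $0$ otherwise. For a permutation $\sigma$ on $\mathbb{N}_k$, the $\sigma$-Hadamard product of $k$ matrices is the $k$-tensor $(H_1\circ_\sigma\cdots\circ_\sigma H_k)^{i_1\dots i_k}=H_1^{i_1i_{\sigma^{-1}(1)}}\cdots H_k^{i_ki_{\sigma^{-1}(k)}}$. A permutation $\sigma$ on $\mathbb{N}_k$ is viewed as a permutation on $\mathbb{N}_{k+1}$ fixing $k+1$, and $\sigma_{(l)}=\sigma\circ\tau_l$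 for $l=1,\dots,k+1$, where $\tau_l=(l,k+1)$ is the transposition ($\tau_{k+1}$ is the identity). For a $k$-tensor $T$ and $l\in\mathbb{N}_k$, the $(k+1)$-tensors $T^{\tau_l}$ and $T^{\tau_l}_{\mathrm{in}}$ are: $(T^{\tau_l})^{i_1\dots i_ki_{k+1}}=T^{i_1\dots i_k}$ if $i_l=i_{k+1}$ and $0$ otherwise; $(T^{\tau_l}_{\mathrm{in}})^{i_1\dots i_ki_{k+1}}=T^{i_1\dots i_{l-1}i_{k+1}i_{l+1}\dots i_k}$ if $i_l\sim i_{k+1}$ and $0$ otherwise. *)

(* Defs.v *)
From mathcomp Require Import all_boot all_order all_fingroup all_algebra.
From mathcomp Require Import reals.

Set Implicit Arguments.
Unset Strict Implicit.
Unset Printing Implicit Defensive.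

Import GRing.Theory.
Local Open Scope ring_scope.

Section Extension.
Variables (A : Type) (k : nat).

(* [ext f x] is f on the first k indices, and x at the last one. *)
Definition ext (f : 'I_k -> A) (x : A) (s : 'I_k.+1) : A :=
  oapp f x (unlift ord_max s).

(* [lift ord_max s] is s seen in 'I_k.+1. *)
Definition init (f : 'I_k.+1 -> A) (s : 'I_k) : A := f (lift ord_max s).

End Extension.

Section Tensors.
Variables (R : realType) (n : nat).

(* Indices are 0-based: 'I_k stands for {1, ..., k}, so in 'I_k.+1 the index
   k+1 is [ord_max]. *)
Definition mindex (k : nat) : finType := {ffun 'I_k -> 'I_n}.

Definition tensor (k : nat) : Type := mindex k -> R.

Definition tensor_app k (T : tensor k.+1) (h : 'rV[R]_n) : tensor k :=
  fun i => \sum_(j < n) T (finfun (ext i j)) * h 0 j.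

Definition tensor_dot k (T1 T2 : tensor k) : R := \sum_(p : mindex k) T1 p * T2 p.

Definition hadamard k (s : 'S_k) (H : 'I_k -> 'M[R]_n) : tensor k :=
  fun i => \prod_(a < k) H a (i a) (i ((s^-1)%g a)).

Definition orthogonal_mx (U : 'M[R]_n) : Prop := U^T *m U = 1%:M.

Definition symmetric_mx (M : 'M[R]_n) : Prop := M^T = M.

Definition tensor_tau k (T : tensor k) (l : 'I_k) : tensor k.+1 :=
  fun i => if init i l == i ord_max then T (finfun (init i)) else 0.

Section Blocks.
Variable mu : 'rV[R]_n.

Definition same_block (i j : 'I_n) : bool := mu 0 i == mu 0 j.

Definition block_constant k (T : tensor k) : Prop :=
  forall i j : mindex k, (forall a, same_block (i a) (j a)) -> T i = T j.

Definition block_diagonal (U : 'M[R]_n) : Prop :=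
  forall i j, ~~ same_block i j -> U i j = 0.

Definition mx_in (H : 'M[R]_n) : 'M[R]_n :=
  \matrix_(i, j) if same_block i j then H i j else 0.

Definition tensor_tau_in k (T : tensor k) (l : 'I_k) : tensor k.+1 :=
  fun i => if same_block (init i l) (i ord_max)
           then T [ffun a => if a == l then i ord_max else init i a] else 0.

End Blocks.
End Tensors.

(* The permutation s o (l, k+1).  Permutations compose left to right in
   [( _ * _ )%g], and [lift_perm ord_max ord_max s] extends s by fixing
   [ord_max]; for l = [ord_max] the transposition is the identity. *)
Definition perm_tau k (s : 'S_k) (l : 'I_k.+1) : 'S_k.+1 :=
  (tperm l ord_max * lift_perm ord_max ord_max s)%g.

(* Main.v *)
(** The pairing of a block-constant tensor with a sigma-Hadamard product is
    invariant under simultaneous conjugation of the factors by a block-diagonal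
    orthogonal matrix.  Conjugating the right-hand sides of both identities
    replaces M_in by Diag h, and the sum over the last index then collapses to
    the left-hand sides. *)

Require Import Defs.
From mathcomp Require Import all_boot all_order all_fingroup all_algebra.
From mathcomp Require Import reals.

Import GRing.Theory.
Local Open Scope ring_scope.

Lemma ext_lift (A : Type) (k : nat) (f : 'I_k -> A) (x : A) (a : 'I_k) :
  ext f x (lift ord_max a) = f a.
Proof. by rewrite /ext liftK. Qed.

Lemma ext_max (A : Type) (k : nat) (f : 'I_k -> A) (x : A) :
  ext f x ord_max = x.
Proof. by rewrite /ext unlift_none. Qed.

(** Lets conjugation pass through [ext]: conjugating all k+1 matrices of an extended family gives
    the extension of the conjugated family. *)
Lemma comp_ext (A B : Type) (g : A -> B) (k : nat) (f : 'I_k -> A) (x : A) :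
  g \o ext f x =1 ext (g \o f) (g x).
Proof. by move=> a; rewrite /ext /=; case: unlift. Qed.

Lemma init_ext (n k : nat) (i : mindex n k) (j : 'I_n) :
  init (finfun (ext i j)) =1 i.
Proof. by move=> a; rewrite /init ffunE ext_lift. Qed.

Lemma sum_mindexS (V : nmodType) (n k : nat) (F : mindex n k.+1 -> V) :
  \sum_p F p = \sum_(i : mindex n k) \sum_(j < n) F (finfun (ext i j)).
Proof.
rewrite pair_bigA /=.
apply: (reindex (fun ij : mindex n k * 'I_n => finfun (ext ij.1 ij.2))).
exists (fun p : mindex n k.+1 => (finfun (init p), p ord_max)).
- move=> [i j] _ /=; rewrite ffunE ext_max; congr pair.
  by apply/ffunP=> a; rewrite ffunE init_ext.
- move=> p _; apply/ffunP=> a; rewrite ffunE /=.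
  case: (unliftP ord_max a) => [b|] ->; last by rewrite ext_max.
  by rewrite ext_lift ffunE.
Qed.

Lemma prod_mulmx (R : comPzRingType) (m n p k : nat)
    (A : 'I_k -> 'M[R]_(m, n)) (B : 'I_k -> 'M[R]_(n, p))
    (i : 'I_k -> 'I_m) (j : 'I_k -> 'I_p) :
  \prod_a (A a *m B a) (i a) (j a) =
  \sum_(q : mindex n k)
    (\prod_a A a (i a) (q a)) * (\prod_a B a (q a) (j a)).
Proof.
under eq_bigr => a _ do rewrite mxE.
by rewrite bigA_distr_bigA; apply: eq_bigr => q _; rewrite big_split.
Qed.

Section Hadamard.
Variables (R : realType) (n : nat).

Lemma eq_hadamard k (s : 'S_k) (H K : 'I_k -> 'M[R]_n) :
  H =1 K -> hadamard s H =1 hadamard s K.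
Proof. by move=> eqHK i; apply: eq_bigr => a _; rewrite eqHK. Qed.

(** Isolates the added matrix [X]: the inverse of [perm_tau s l] sends the last position to [l], so
    [X] is evaluated at row [i ord_max] and column [i l]. *)
Lemma hadamard_ext k (s : 'S_k) (l : 'I_k.+1) (H : 'I_k -> 'M[R]_n)
    (X : 'M[R]_n) (i : mindex n k.+1) :
  hadamard (perm_tau s l) (ext H X) i =
  (\prod_(a < k) H a (init i a)
     (i (tperm l ord_max (lift ord_max ((s^-1)%g a))))) * X (i ord_max) (i l).
Proof.
rewrite /hadamard /perm_tau invMg tpermV lift_permV.
rewrite (bigD1_ord ord_max) //= mulrC ext_max permM lift_perm_id tpermR.
by congr (_ * _); apply: eq_bigr => a _; rewrite ext_lift permM lift_perm_lift.
Qed.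

(** The product vanishes unless [p a] and [i a] lie in one block for every [a], and then [T] takes
    the same value at [i] and [p]. *)
Lemma block_constant_prod (mu : 'rV[R]_n) (U : 'M[R]_n) k (T : tensor R n k)
    (i p : mindex n k) :
  block_diagonal mu U -> block_constant mu T ->
  T i * \prod_a U (p a) (i a) = T p * \prod_a U (p a) (i a).
Proof.
move=> U_blk T_blk.
have [blk|/forallPn[a nblk]] := boolP [forall a, same_block mu (p a) (i a)].
  by congr (_ * _); symmetry; apply: T_blk => a; apply: (forallP blk).
by rewrite (bigD1 a) //= U_blk // mul0r !mulr0.
Qed.

Lemma tensor_dot_conj (mu : 'rV[R]_n) (U : 'M[R]_n) k (T : tensor R n k)
    (s : 'S_k) (H : 'I_k -> 'M[R]_n) :
  orthogonal_mx U -> block_diagonal mu U -> block_constant mu T ->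
  tensor_dot T (hadamard s (fun a => U^T *m H a *m U)) =
  tensor_dot T (hadamard s H).
Proof.
move=> U_orth U_blk T_blk.
have UUT : U *m U^T = 1%:M by apply: mulmx1C.
pose c (p q : mindex n k) := \prod_a H a (p a) (q a).
(* Each conjugated entry expands into a sum over inner indices [p a], [q a]. Trading [T i] for [T p]
   leaves [i] only in the entries of [U], so the sum over [i] can be done first. *)
transitivity (\sum_(p : mindex n k) \sum_(q : mindex n k) \sum_(i : mindex n k)
    T p * c p q *
    ((\prod_a U (p a) (i a)) * (\prod_a U^T (i a) (q (s a))))).
  rewrite exchange_big; under [RHS]eq_bigr => q _ do rewrite exchange_big.
  rewrite exchange_big; apply: eq_bigr => i _.
  rewrite /hadamard prod_mulmx mulr_sumr; apply: eq_bigr => q _.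
  rewrite prod_mulmx mulr_suml mulr_sumr; apply: eq_bigr => p _.
  have -> : \prod_a U^T (i a) (p a) = \prod_a U (p a) (i a).
    by apply: eq_bigr => a _; rewrite mxE.
  have -> : \prod_a U (q a) (i ((s^-1)%g a)) = \prod_a U^T (i a) (q (s a)).
    (* Substituting [s a] for [a] makes each column index [i a], to be matched with that of
       [U (p a) (i a)]. *)
    rewrite (reindex_inj (@perm_inj _ s)).
    by apply: eq_bigr => a _; rewrite permK mxE.
  have := block_constant_prod mu U k T i p U_blk T_blk.
  rewrite -/(c p q); move: (\prod_a U _ _) (\prod_a U^T _ _) => x y Tx.
  by rewrite -!(mulrA x) (mulrA (T i)) Tx -mulrA -(mulrA (T p)) (mulrCA x).
apply: eq_bigr => p _.
(* The sum over [i] factors into the entries of [U *m U^T] at [(p a, q (s a))], which are Kronecker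
   deltas. *)
under eq_bigr => q _.
  rewrite -mulr_sumr -prod_mulmx.
  under [X in _ * X]eq_bigr => a _ do rewrite UUT mxE.
  over.
(* The deltas force [q (s a) = p a] for all [a]; this is the only surviving [q], and it yields the
   Hadamard product of the [H a] at [p]. *)
pose q0 : mindex n k := [ffun a => p ((s^-1)%g a)].
rewrite (bigD1 q0) //= [X in _ + X]big1 => [|q neq_q].
  rewrite addr0 [X in _ * X]big1 ?mulr1 => [|a _]; last by rewrite ffunE permK eqxx.
  by congr (_ * _); apply: eq_bigr => a _; rewrite ffunE.
have [/forallP pq|/forallPn[a /negPf npq]] := boolP [forall a, p a == q (s a)].
  case/eqP: neq_q; apply/ffunP=> a.
  by rewrite ffunE (eqP (pq _)) permKV.
by rewrite (bigD1 a) //= npq mul0r mulr0.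
Qed.

(** Makes conjugation invariance available for [tensor_tau_in]; [tensor_tau], which tests equality
    of indices, is in general not block-constant. *)
Lemma block_constant_tau_in (mu : 'rV[R]_n) k (T : tensor R n k) (l : 'I_k) :
  block_constant mu T -> block_constant mu (tensor_tau_in mu T l).
Proof.
move=> T_blk i j ij; rewrite /tensor_tau_in /same_block /init.
rewrite (eqP (ij (lift ord_max l))) (eqP (ij ord_max)).
case: ifP => // _; apply: T_blk => a; rewrite !ffunE.
by case: (a == l); apply: ij.
Qed.

Lemma tensor_dot_app k (T : tensor R n k.+1) (h : 'rV[R]_n) (s : 'S_k)
    (H : 'I_k -> 'M[R]_n) :
  tensor_dot (tensor_app T h) (hadamard s H) =
  tensor_dot T (hadamard (perm_tau s ord_max) (ext H (diag_mx h))).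
Proof.
rewrite [RHS]/tensor_dot sum_mindexS; apply: eq_bigr => i _.
rewrite mulr_suml; apply: eq_bigr => j _.
rewrite hadamard_ext ffunE ext_max mxE eqxx mulr1n -mulrA; congr (_ * _).
rewrite mulrC; congr (_ * _); apply: eq_bigr => a _.
by rewrite init_ext tperm1 perm1 ffunE ext_lift.
Qed.

(** The factor [diag_mx h] restricts the right-hand sum to [j = i l]. There both tensors take the
    value [T i]. *)
Lemma tensor_dot_tau_app (mu : 'rV[R]_n) k (T : tensor R n k) (l : 'I_k)
    (h : 'rV[R]_n) (s : 'S_k) (H : 'I_k -> 'M[R]_n) :
  tensor_dot (tensor_app (tensor_tau T l) h) (hadamard s H) =
  tensor_dot (tensor_tau_in mu T l)
    (hadamard (perm_tau s (lift ord_max l)) (ext H (diag_mx h))).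
Proof.
rewrite [RHS]/tensor_dot sum_mindexS; apply: eq_bigr => i _.
rewrite mulr_suml; apply: eq_bigr => j _.
rewrite hadamard_ext /tensor_tau /tensor_tau_in !init_ext !ffunE ext_max.
rewrite ext_lift mxE [j == _]eq_sym.
have [<-|_] := eqVneq (i l) j; last by rewrite mulr0n !mulr0 !mul0r.
rewrite /same_block eqxx mulr1n -mulrA [h 0 _ * _]mulrC; congr (_ * (_ * _)).
  congr T; apply/ffunP=> a; rewrite !ffunE init_ext.
  by case: eqP => [->|].
(* Since positions [l] and [ord_max] now carry the same index, the transposition leaves the entries
   unchanged. *)
apply: eq_bigr => a _; rewrite init_ext ffunE.
by case: tpermP => [/lift_inj->|/eqP|_ _]; rewrite ?ext_max ?ext_lift //
   eq_sym (negPf (neq_lift _ _)).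
Qed.

End Hadamard.

Theorem theorem5p4 (R : realType) (n k : nat) (mu : 'rV[R]_n)
    (U : 'M[R]_n) (U_orth : orthogonal_mx U) (U_blk : block_diagonal mu U)
    (M : 'M[R]_n) (M_sym : symmetric_mx M)
    (h : 'rV[R]_n) (UMU : U^T *m mx_in mu M *m U = diag_mx h)
    (H : 'I_k -> 'M[R]_n) (s : 'S_k) :
  let tH := fun a : 'I_k => U^T *m H a *m U in
  (forall T : tensor R n k.+1, block_constant mu T ->
     tensor_dot (tensor_app T h) (hadamard s tH) =
     tensor_dot T (hadamard (perm_tau s ord_max) (ext H (mx_in mu M))))
  /\
  (forall T : tensor R n k, block_constant mu T ->
     forall l : 'I_k,
     tensor_dot (tensor_app (tensor_tau T l) h) (hadamard s tH) =
     tensor_dot (tensor_tau_in mu T l)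
       (hadamard (perm_tau s (lift ord_max l)) (ext H (mx_in mu M)))).
Proof.
move=> tH.
have conj_ext (s' : 'S_k.+1) (T : tensor R n k.+1) : block_constant mu T ->
    tensor_dot T (hadamard s' (ext tH (diag_mx h))) =
    tensor_dot T (hadamard s' (ext H (mx_in mu M))).
  (* Conjugation is introduced on the right, where [UMU] turns the last factor into [diag_mx h]. *)
  move=> T_blk; rewrite -[RHS](tensor_dot_conj _ _ mu U _ T s' _ U_orth U_blk T_blk).
  apply: eq_bigr => i _; congr (_ * _); apply: eq_hadamard => a.
  by rewrite -UMU; symmetry; exact: (comp_ext _ _ (fun X => U^T *m X *m U) k H _ a).
split=> T T_blk => [|l].
  by rewrite tensor_dot_app conj_ext.
by rewrite (tensor_dot_tau_app _ _ mu) conj_ext //; apply: block_constant_tau_in.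
Qed.
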